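(* Let $n\ge 1$ and let $\mu,\nu,\lambda\in \mathsf{Par}_n$ with $N_{\mu,\nu,\lambda}>0$. Then for every tuple $(A,A',B,B',C,C')\in\mathcal{G}_n$, $$0\leq \sum_{i\in A} \mu_i - \sum_{i\in A'} \mu_i + \sum_{j\in B} \nu_j - \sum_{j\in B'} \nu_j + \sum_{k\in C} \lambda_k - \sum_{k\in C'} \lambda_k .$$
   Context: $\mathsf{Par}_n=\{(\lambda_1,\dots,\lambda_n)\in\mathbb{Z}_{\ge0}^n:\lambda_1\ge\cdots\ge\lambda_n\}$, and $[n]=\{1,\dots,n\}$. $c^{\gamma}_{\alpha,\beta}$ denotes the Littlewood–Richardson coefficient (partitions are identified up to trailing zeros). The Newell–Littlewood number is $N_{\mu,\nu,\lambda}=\sum_{\alpha,\beta,\gamma} c^{\mu}_{\alpha,\beta}c^{\nu}_{\alpha,\gamma}c^{\lambda}_{\beta,\gamma}$, summed over all partitions $\alpha,\beta,\gamma$. For a finite set $I=\{i_1<\cdots<i_d\}\subseteq\mathbb{Z}_{>0}$, $\tau(I)=(i_d-d\ge\cdots\ge i_2-2\ge i_1-1)$, a partition with at most $d$ parts. $\mathcal{G}_n$ is the set of tuples $(A,A',B,B',C,C')$ of subsets of $[n]$ such that: (I) $A\cap A'=B\cap B'=C\cap C'=\emptyset$; (II) $|A|=|B'|+|C'|$, $|B|=|A'|+|C'|$, $|C|=|A'|+|B'|$; (III) there exist $A_1,A_2,B_1,B_2,C_1,C_2\subseteq[n]$ with (1) $|A_1|=|A_2|=|A'|$, $|B_1|=|B_2|=|B'|$,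 $|C_1|=|C_2|=|C'|$; (2) $c^{\tau(A')}_{\tau(A_1),\tau(A_2)}>0$, $c^{\tau(B')}_{\tau(B_1),\tau(B_2)}>0$, $c^{\tau(C')}_{\tau(C_1),\tau(C_2)}>0$; (3) $c^{\tau(A)}_{\tau(B_1),\tau(C_2)}>0$, $c^{\tau(B)}_{\tau(C_1),\tau(A_2)}>0$, $c^{\tau(C)}_{\tau(A_1),\tau(B_2)}>0$. The displayed inequality for such a tuple is called an extended Horn inequality. *)

(* Defs.v *)
From HB Require Import structures.
From mathcomp Require Import all_boot all_order all_algebra.
From mathcomp Require Import boolp classical_sets functions cardinality fsbigop.

Set Implicit Arguments.
Unset Strict Implicit.
Unset Printing Implicit Defensive.

(* A partition is read off a weakly decreasing sequence of naturals through
   [nth 0], so that trailing zeros are immaterial. Rows, columns and parts are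
   numbered from 0. *)

Definition part_at (s : seq nat) (i : nat) : nat := nth 0 s i.

Definition Par (n : nat) : {pred n.-tuple nat} :=
  [pred s : n.-tuple nat | sorted geq s].
Arguments Par : clear implicits.

(* Each partition has exactly one representative in [intpart], the one without
   zero parts. *)
Definition is_intpart (s : seq nat) : bool := sorted geq s && (0 \notin s).

Record intpart := IntPart { parts :> seq nat; _ : is_intpart parts }.

HB.instance Definition _ := [isSub for parts].
HB.instance Definition _ := [Choice of intpart by <:].

Section LittlewoodRichardson.
Variables gamma alpha beta : seq nat.

(* A filling of the bounding rectangle of gamma: the letters are
   1, ..., size beta, and 0 marks a cell that carries no entry. *)
Definition filling :=
  {ffun 'I_(size gamma) * 'I_(part_at gamma 0) -> 'I_(size beta).+1}.

Definition contained : bool :=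
  all (fun i => part_at alpha i <= part_at gamma i) (iota 0 (size alpha)).

Definition in_skew (x : 'I_(size gamma) * 'I_(part_at gamma 0)) : bool :=
  part_at alpha x.1 <= x.2 < part_at gamma x.1.

Definition has_skew_shape (T : filling) : bool :=
  contained && [forall x, (T x != 0 :> nat) == in_skew x].

Definition semistandard (T : filling) : bool :=
  [forall x, forall y, in_skew x && in_skew y ==>
     ((x.1 == y.1) && (x.2 < y.2) ==> (T x <= T y)) &&
     ((x.2 == y.2) && (x.1 < y.1) ==> (T x < T y))].

Definition has_content (T : filling) : bool :=
  [forall k : 'I_(size beta), #|[pred x | T x == k.+1 :> nat]| == part_at beta k].

(* Rows are read from top to bottom, each of them from right to left. *)
Definition reading_word (T : filling) : seq nat :=
  [seq a <- [seq (T (i, j) : nat) | i <- enum 'I_(size gamma),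
                                    j <- rev (enum 'I_(part_at gamma 0))]
     | a != 0].

Definition lattice_word (w : seq nat) : Prop :=
  forall p k : nat, 0 < k ->
    count_mem k.+1 (take p w) <= count_mem k (take p w).

Definition is_LR_tableau (T : filling) : bool :=
  [&& has_skew_shape T, semistandard T, has_content T
    & `[< lattice_word (reading_word T) >]].

(* lrcoef gamma alpha beta = c^gamma_(alpha, beta): the number of
   Littlewood-Richardson tableaux of shape gamma / alpha and content beta. *)
Definition lrcoef : nat := #|[pred T : filling | is_LR_tableau T]|.

End LittlewoodRichardson.

Definition NL_term (mu nu lambda : seq nat) (t : intpart * intpart * intpart)
    : nat :=
  let: (alpha, beta, gamma) := t in
  lrcoef mu alpha beta * lrcoef nu alpha gamma * lrcoef lambda beta gamma.

(* The finitely supported sum over all triples of partitions; the support is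
   finite by [finite_NL_support]. *)
Definition NL (mu nu lambda : seq nat) : nat :=
  \big[addn/0]_(t \in [set: intpart * intpart * intpart]%classic)
    NL_term mu nu lambda t.

(* Counting from 0 instead of 1 leaves each i_k - k unchanged. *)
Definition tau (n : nat) (I : {set 'I_n}) : seq nat :=
  rev (mkseq (fun k => nth 0 [seq val i | i <- enum I] k - k) #|I|).

Definition calG (n : nat) (A A' B B' C C' : {set 'I_n}) : Prop :=
  [/\ [/\ [disjoint A & A'], [disjoint B & B'] & [disjoint C & C']],
      [/\ #|A| = #|B'| + #|C'|, #|B| = #|A'| + #|C'| & #|C| = #|A'| + #|B'|]
    & exists A1 A2 B1 B2 C1 C2 : {set 'I_n},
      [/\ [/\ #|A1| = #|A'| /\ #|A2| = #|A'|,
              #|B1| = #|B'| /\ #|B2| = #|B'|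
            & #|C1| = #|C'| /\ #|C2| = #|C'|],
          [/\ 0 < lrcoef (tau A') (tau A1) (tau A2),
              0 < lrcoef (tau B') (tau B1) (tau B2)
            & 0 < lrcoef (tau C') (tau C1) (tau C2)]
        & [/\ 0 < lrcoef (tau A) (tau B1) (tau C2),
              0 < lrcoef (tau B) (tau C1) (tau A2)
            & 0 < lrcoef (tau C) (tau A1) (tau B2)]]].

Lemma lrcoef_gt0P (g a b : seq nat) :
  reflect (exists T : filling g b, is_LR_tableau a T) (0 < lrcoef g a b).
Proof.
apply: (iffP card_gt0P) => -[T HT]; exists T; first by move: HT; rewrite inE.
by rewrite inE.
Qed.

Definition box (M : nat) : set intpart :=
  [set p : intpart | size p <= M /\ forall i, nth 0 p i <= M]%classic.

Lemma finite_box M : finite_set (box M).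
Proof.
pose f (x : {ffun 'I_M -> 'I_M.+1} * 'I_M.+1) : seq nat :=
  take x.2 [seq (x.1 i : nat) | i <- enum 'I_M].
have fin : finite_set (f @` setT)%classic.
  exact/finite_image/finite_finset.
pose g (s : seq nat) : intpart := insubd (IntPart (isT : is_intpart [::])) s.
apply: sub_finite_set (finite_image g fin) => p [sp bp].
exists (val p); last by rewrite /g valKd.
have sp' : size p < M.+1 by [].
pose u : {ffun 'I_M -> 'I_M.+1} := [ffun i : 'I_M => inord (nth 0 p i)].
exists (u, Ordinal sp') => //.
have st : size (f (u, Ordinal sp')) = size p.
  by rewrite size_takel // size_map size_enum_ord.
apply: (@eq_from_nth _ 0) => // i; rewrite st => ip.
have iM : i < M by exact: leq_trans ip sp.
rewrite nth_take // (nth_map (Ordinal iM)) ?size_enum_ord // ffunE.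
by rewrite nth_enum_ord // inordK // ltnS.
Qed.

Lemma lrcoef_box (g : seq nat) (a b : intpart) : 0 < lrcoef g a b ->
  box (size g + part_at g 0 + \max_(x <- g) x + size g * part_at g 0) a /\
  box (size g + part_at g 0 + \max_(x <- g) x + size g * part_at g 0) b.
Proof.
have pos (p : intpart) i : i < size p -> 0 < nth 0 p i.
  move=> ip; rewrite lt0n; apply/eqP => e.
  by case: p ip e => s /= /andP[_ /negP n0] ip e; apply: n0; rewrite -e mem_nth.
case/lrcoef_gt0P => T /and4P[/andP[/allP sub _] _ /forallP cont _].
have lea i : nth 0 a i <= nth 0 g i.
  case: (ltnP i (size a)) => ia; last by rewrite nth_default.
  by apply: sub; rewrite mem_iota.
have maxg i : nth 0 g i <= \max_(x <- g) x.
  case: (ltnP i (size g)) => ig; last by rewrite nth_default.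
  by rewrite (big_rem (nth 0 g i)) ?mem_nth //= leq_maxl.
have sumb : \sum_(k < size b) nth 0 b k <= size g * part_at g 0.
  have -> : size g * part_at g 0 = #|{: 'I_(size g) * 'I_(part_at g 0)}|.
    by rewrite card_prod !card_ord.
  have -> : \sum_(k < size b) nth 0 b k =
            \sum_(k < size b) \sum_(x | T x == lift ord0 k) 1.
    apply: eq_bigr => k _; rewrite sum1_card -/(part_at b k); have /eqP <- := cont k.
    by apply: eq_card => x; rewrite !inE.
  have -> : #|{: 'I_(size g) * 'I_(part_at g 0)}| =
      \sum_(k < (size b).+1) \sum_(x | T x == k) 1.
    by rewrite -sum1_card (partition_big T predT).
  by rewrite [leqRHS]big_ord_recl /= leq_addl.
split; split.
- suff: size a <= size g by move=> h; rewrite -!addnA; apply: leq_trans h (leq_addr _ _).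
  rewrite leqNgt; apply/negP => h; have := leq_trans (pos _ _ h) (lea _).
  by rewrite nth_default.
- move=> i; apply: leq_trans (lea i) _; apply: leq_trans (maxg i) _.
  by rewrite -addnA addnCA leq_addr.
- apply: leq_trans (leq_addl _ _); apply: leq_trans sumb.
  rewrite -{1}(card_ord (size b)) -sum1_card.
  by apply: leq_sum => k _; apply: pos.
- move=> i; apply: leq_trans (leq_addl _ _); apply: leq_trans sumb.
  case: (ltnP i (size b)) => ib; last by rewrite nth_default.
  by rewrite (bigD1 (Ordinal ib)) //= leq_addr.
Qed.

Lemma finite_NL_support (mu nu lambda : seq nat) :
  finite_set [set t | NL_term mu nu lambda t != 0]%classic.
Proof.
pose M g := size g + part_at g 0 + \max_(x <- g) x + size g * part_at g 0.
apply: (@sub_finite_set _ _ (box (M mu) `*` box (M mu) `*` box (M nu))%classic).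
  move=> [[a b] c] /=; rewrite -lt0n !muln_gt0 => /andP[/andP[h1 h2] _].
  by have [? ?] := lrcoef_box h1; have [? ?] := lrcoef_box h2.
by do 2?[apply: finite_setX]; apply: finite_box.
Qed.

(* Main.v *)
Require Import Defs.
From mathcomp Require Import all_boot all_order all_algebra.
From mathcomp Require Import boolp classical_sets fsbigop zify.

Set Implicit Arguments.
Unset Strict Implicit.
Unset Printing Implicit Defensive.

(* A Littlewood-Richardson tableau is the same as a hive. A small hive, attached
   to subsets I, J, K through tau, prescribes positions in a big hive of shape
   (g; a, b) at which unit triangles are placed, and the rhombus inequalities of
   the big hive let the sum of the triangle identities telescope to the Horn
   inequality g_K <= b_I + a_J (if |I| = |J| = |K|) or g_K >= b_I + a_J (if
   |K| = |I| + |J|). The roles of a and b are exchanged by switching tableaux,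
   which on partial sums is the octahedron recurrence. If N_(mu, nu, lambda) > 0
   then mu, nu, lambda come from (alpha, beta), (alpha, gamma), (beta, gamma),
   and the three upper and three lower Horn inequalities given by A', B', C' and
   A, B, C add up to the theorem: the terms in alpha, beta, gamma cancel. *)

(* For a tableau of shape g / a and content b with letters and rows numbered
   from 0: X k i is the length of row i of the shape filled by a and the letters
   less than k, and Y k i is the number of letters k in the rows above row i. *)
Record lr_pattern (N : nat) (g a b : nat -> nat) (X Y : nat -> nat -> nat) :
    Prop := LRPattern {
  lrp_tri : forall k i, X k i + Y k i.+1 = X k.+1 i + Y k i;
  lrp_incr : forall k i, X k i <= X k.+1 i;
  lrp_strict : forall k i, X k.+1 i.+1 <= X k i;
  lrp_lattice : forall k i, Y k.+1 i.+1 <= Y k i;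
  lrp_Y0 : forall k, Y k 0 = 0;
  lrp_inner : forall i, X 0 i = a i;
  lrp_outer : forall k i, N <= k -> X k i = g i;
  lrp_content : forall k i, N <= i -> Y k i = b k;
  lrp_supp : forall i, N <= i -> g i = 0 }.

(** * Rhombus inequalities and boundary values of a hive *)

Section PatternTheory.
Variables (N : nat) (g a b : nat -> nat) (X Y : nat -> nat -> nat).
Hypothesis P : lr_pattern N g a b X Y.

(** Raising [k] and [i] together lowers [X] by column strictness, and [X] grows with [k] alone; the
    hypotheses describe the combinations of these moves. *)
Lemma lrp_Xle k i k' i' : i <= i' -> k' + i <= k + i' -> X k' i' <= X k i.
Proof.
move=> le_i; rewrite -(subnK le_i) addnA leq_add2r addnC.
move: (i' - i) => d {i' le_i} le_k.
have mono m l : X m (d + i) <= X (m + l) (d + i).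
  elim: l => [|l IH]; first by rewrite addn0.
  by rewrite addnS; apply: leq_trans IH (lrp_incr P _ _).
have diag : X (d + k) (d + i) <= X k i.
  elim: d {le_k mono} => [//|d IH]; rewrite !addSn.
  exact: leq_trans (lrp_strict P _ _) IH.
by apply: leq_trans diag; rewrite -(subnKC le_k).
Qed.

Lemma lrp_Yle k i k' i' : k <= k' -> i' + k <= i + k' -> Y k' i' <= Y k i.
Proof.
move=> le_k; rewrite -(subnK le_k) addnA leq_add2r addnC.
move: (k' - k) => d {k' le_k} le_i.
have mono m l : Y (d + k) m <= Y (d + k) (m + l).
  elim: l => [|l IH]; first by rewrite addn0.
  rewrite addnS; apply: leq_trans IH _.
  have := lrp_tri P (d + k) (m + l); have := lrp_incr P (d + k) (m + l); lia.
have diag : Y (d + k) (d + i) <= Y k i.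
  elim: d {le_i mono} => [//|d IH]; rewrite !addSn.
  exact: leq_trans (lrp_lattice P _ _) IH.
by apply: leq_trans diag; rewrite -(subnKC le_i).
Qed.

(* The labels of the third direction of edges of the hive. *)
Definition lrp_gam k i := X k i + Y k i.+1.

Lemma lrp_gamE k i : lrp_gam k i = X k.+1 i + Y k i.
Proof. exact: lrp_tri P k i. Qed.

(** Writing two neighbouring labels by the two different expressions leaves a common term: a unit
    step in [k] is the lattice inequality, one in [i] is column strictness. *)
Lemma lrp_gamle k i k' i' : k <= k' -> i <= i' -> lrp_gam k' i' <= lrp_gam k i.
Proof.
move=> le_k le_i; apply: (@leq_trans (lrp_gam k i')).
  rewrite -(subnK le_k); elim: (k' - k) => [//|d IH].
  apply: leq_trans IH; rewrite addSn [leqRHS]lrp_gamE leq_add2l.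
  exact: lrp_lattice P _ _.
rewrite -(subnK le_i); elim: (i' - i) => [//|d IH].
apply: leq_trans IH; rewrite addSn [leqLHS]lrp_gamE leq_add2r.
exact: lrp_strict P _ _.
Qed.

Lemma lrp_Ydiag k i : i <= k -> Y k i = 0.
Proof.
move=> le_ik; apply/eqP; rewrite -leqn0 -(lrp_Y0 P 0).
by apply: lrp_Yle; rewrite ?addn0.
Qed.

(** Letters [k] and above do not occur in row [i], so this row is already complete. *)
Lemma lrp_Xlast k i : i < k -> X k i = g i.
Proof.
move=> lt_ik; rewrite -(lrp_outer P i (leq_addl k N)).
elim: N => [|d]; rewrite ?addn0 // addnS => ->.
have := lrp_tri P (k + d) i; rewrite !lrp_Ydiag //; lia.
Qed.

Lemma lrp_Xge k i : a i <= X k i.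
Proof. by rewrite -(lrp_inner P) lrp_Xle ?leq_addl. Qed.

Lemma lrp_Xle_inner k i j : k + j <= i -> X k i <= a j.
Proof. by move=> h; rewrite -(lrp_inner P) lrp_Xle //; lia. Qed.

Lemma lrp_Xle_outer k i : X k i <= g i.
Proof.
by rewrite -(lrp_outer P i (leq_maxl N k)) lrp_Xle // leq_add2r leq_maxr.
Qed.

Lemma lrp_Yle_content k i : Y k i <= b k.
Proof.
by rewrite -(lrp_content P k (leq_maxl N i)) lrp_Yle // leq_add2r leq_maxr.
Qed.

Lemma lrp_gamge_outer k i : g i <= lrp_gam k i.
Proof.
apply: (@leq_trans (lrp_gam (maxn k N) i)); last by rewrite lrp_gamle ?leq_maxl.
by rewrite lrp_gamE (lrp_outer P) ?leq_addr // leqW ?leq_maxr.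
Qed.

Lemma lrp_gamge_content k i : b k <= lrp_gam k i.
Proof.
apply: (@leq_trans (lrp_gam k (maxn i N))); last by rewrite lrp_gamle ?leq_maxl.
by rewrite lrp_gamE (lrp_content P) ?leq_addl // leq_maxr.
Qed.

Lemma lrp_gamle_outer k i : k <= i -> lrp_gam k i <= g k.
Proof.
move=> le_ki; apply: (@leq_trans (lrp_gam k k)); first exact: lrp_gamle.
by rewrite lrp_gamE lrp_Xlast // lrp_Ydiag // addn0.
Qed.

Lemma lrp_outer_anti i j : i <= j -> g j <= g i.
Proof.
move=> le_ij; rewrite -(lrp_outer P i (leqnn N)) -(lrp_outer P j (leqnn N)).
by apply: lrp_Xle; rewrite // leq_add2l.
Qed.

Lemma lrp_inner_anti i j : i <= j -> a j <= a i.
Proof.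
by move=> le_ij; rewrite -!(lrp_inner P); apply: lrp_Xle.
Qed.

Lemma lrp_Yfull k i : (forall j, i <= j -> X k.+1 j = 0) -> Y k i = b k.
Proof.
move=> X0; rewrite -(lrp_content P k (leq_addl i N)).
elim: N => [|d IH]; first by rewrite addn0.
rewrite addnS IH; have := lrp_tri P k (i + d); have := lrp_incr P k (i + d).
rewrite X0 ?leq_addr //; lia.
Qed.

End PatternTheory.

(** * Horn inequalities from a pair of hives *)

(* A small pattern dictates where the unit triangles are put in the hive with
   edge labels X, Y and lrp_gam; edges shared by neighbouring triangles of the
   small pattern are then comparable in the big hive, and the sum over a row of
   triangles telescopes. *)
Lemma horn_upper N g a b X Y M z x y U V r :
  lr_pattern N g a b X Y -> lr_pattern M z x y U V ->
  (forall i, r <= i -> z i = 0) ->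
  \sum_(0 <= i < r) g (r - i.+1 + z i) <=
  \sum_(0 <= i < r) b (r - i.+1 + x i) + \sum_(0 <= i < r) a (r - i.+1 + y i).
Proof.
move=> P Q z0.
have U0 k i : r <= i -> U k i = 0.
  by move=> /z0 zi; have := lrp_Xle_outer Q k i; rewrite zi leqn0 => /eqP.
(* [kU] and [iU] place the triangle [(k, i)] of the small hive in the big one; [S k] collects the
   [Y] edges of row [k] of triangles. *)
pose kU k i := r - i.+1 + U k i.
pose iU k i := r - k.+1 + U k i + V k i.+1.
pose S k := \sum_(k <= i < r) Y (kU k i) (iU k i).+1.
have step k : k < r -> g (r - k.+1 + z k) + S k.+1 <= a (r - k.+1 + y k) + S k.
  move=> ltkr.
  have row m : k <= m < r ->
    g (r - k.+1 + z k) + \sum_(k.+1 <= i < m.+1) Y (kU k.+1 i) (iU k.+1 i).+1 <=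
    X (kU k m) (iU k m) + \sum_(k <= i < m.+1) Y (kU k i) (iU k i).+1.
    elim: m => [|m IH] /andP[lekm ltmr].
      have -> : k = 0 by lia.
      rewrite [in leqLHS]big_geq // big_nat1 addn0.
      have -> : r - 1 + z 0 = iU 0 0.
        have := lrp_tri Q 0 0; rewrite (lrp_Y0 Q) (lrp_Xlast Q (ltnSn _)) /iU; lia.
      exact: lrp_gamge_outer P _ _.
    case: (leqP k m) => lekm'; last first.
      have -> : k = m.+1 by lia.
      rewrite [in leqLHS]big_geq // big_nat1 addn0.
      have -> : r - m.+2 + z m.+1 = iU m.+1 m.+1.
        have := lrp_tri Q m.+1 m.+1.
        rewrite (lrp_Ydiag Q (leqnn _)) (lrp_Xlast Q (ltnSn _)) /iU; lia.
      exact: lrp_gamge_outer P _ _.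
    have {}IH := IH (introT andP (conj lekm' (ltnW ltmr))).
    rewrite big_nat_recr //= [X in _ <= _ + X]big_nat_recr //=.
    (* This triangle fits between [(k, m)], [(k, m.+1)] and [(k.+1, m.+1)]: each of its edges is
       comparable to an edge of one of them. *)
    pose kD := r - m.+2 + U k.+1 m.+1.
    pose iD := r - k.+1 + U k.+1 m.+1 + V k m.+1.
    have tr := lrp_tri Q k m.+1.
    have inc := lrp_incr Q k m.+1; have str := lrp_strict Q k m.
    have lat := lrp_lattice Q k m.+1; have inc' := lrp_incr Q k.+1 m.+1.
    have gD : lrp_gam X Y kD iD <= lrp_gam X Y (kU k m.+1) (iU k m.+1).
      apply: (lrp_gamle P); rewrite /kU /iU /kD /iD; lia.
    have gDE := lrp_gamE P kD iD.
    have bD : Y (kU k.+1 m.+1) (iU k.+1 m.+1).+1 <= Y kD iD.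
      apply: (lrp_Yle P); rewrite /kU /iU /kD /iD; lia.
    have aD : X (kU k m) (iU k m) <= X kD.+1 iD.
      apply: (lrp_Xle P); rewrite /kU /iU /kD /iD; lia.
    rewrite /lrp_gam in gD gDE; lia.
  have r_gt0 : 0 < r by exact: leq_trans ltkr.
  have := row r.-1; rewrite prednK //= => /(_ _) /leq_trans; apply; first lia.
  (* The [X] edge left at the end of the row is bounded by a part of [a]: the small shape has no row
     [r], so [V k r] is [y k]. *)
  rewrite leq_add2r; apply: (lrp_Xle_inner P); rewrite /kU /iU prednK //.
  rewrite (lrp_Yfull Q) => [|j lerj]; last exact: U0.
  lia.
have tel m : m <= r -> \sum_(0 <= i < m) g (r - i.+1 + z i) + S m <=
    \sum_(0 <= i < m) a (r - i.+1 + y i) + S 0.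
  elim: m => [|m IH] lemr; first by rewrite !big_geq.
  rewrite !big_nat_recr //=; have := step m lemr; have := IH (ltnW lemr); lia.
have := tel r (leqnn r); rewrite {1}/S (big_geq (leqnn r)) addn0 => /leq_trans.
apply; rewrite addnC leq_add2r; apply: leq_sum => i _.
by rewrite /kU (lrp_inner Q); apply: lrp_Yle_content P _ _.
Qed.

Lemma horn_lower N g a b X Y M z x y U V p q :
  lr_pattern N g a b X Y -> lr_pattern M z x y U V ->
  (forall i, p <= i -> x i = 0) -> (forall k, q <= k -> y k = 0) ->
  \sum_(0 <= i < p) b (p - i.+1 + x i) + \sum_(0 <= i < q) a (q - i.+1 + y i) <=
  \sum_(0 <= i < p + q) g (p + q - i.+1 + z i).
Proof.
move=> P Q x0 y0.
have U0 k i : p + k <= i -> U k i = 0.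
  move=> lei; apply/eqP; rewrite -leqn0.
  by rewrite -(x0 p (leqnn p)) (lrp_Xle_inner Q) // addnC.
have V0 i : V q i = 0.
  by apply/eqP; rewrite -leqn0 -(y0 q (leqnn q)) (lrp_Yle_content Q).
pose kD k i := p + k - i.+1 + U k i.
pose iD k i := kD k i + (q - k) + V k i.+1.
pose kU k i := p + k - i + U k.+1 i.
pose iU k i := kU k i + (q - k.+1) + V k i.
(* [G 0] bounds the parts of [b] from above, [G q] bounds those of [g] from below, and each step
   absorbs one part of [a]. *)
pose G k := \sum_(0 <= i < p + k) lrp_gam X Y (kD k i) (iD k i).
have G0 : \sum_(0 <= i < p) b (p - i.+1 + x i) <= G 0.
  rewrite /G addn0; apply: leq_sum => i _.
  apply: leq_trans (lrp_gamge_content P _ _).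
  by rewrite /kD (lrp_inner Q) addn0.
have step k : k < q -> a (q - k.+1 + y k) + G k <= G k.+1.
  move=> ltkq.
  have row m : m <= p + k ->
    \sum_(0 <= i < m) lrp_gam X Y (kD k i) (iD k i) + X (kU k m) (iU k m) <=
    \sum_(0 <= i < m.+1) lrp_gam X Y (kU k i) (iU k i).
    elim: m => [|m IH] lem.
      by rewrite big_geq // big_nat1 /lrp_gam leq_addr.
    have {}IH := IH (ltnW lem); rewrite big_nat_recr //= [leqRHS]big_nat_recr //=.
    have tr := lrp_tri Q k m.
    have inc := lrp_incr Q k m; have str := lrp_strict Q k m.
    have gDE := lrp_gamE P (kD k m) (iD k m).
    have bD : Y (kD k m) (iD k m) <= Y (kU k m.+1) (iU k m.+1).+1.
      apply: (lrp_Yle P); rewrite /iU /kU /iD /kD; lia.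
    have aD : X (kD k m).+1 (iD k m) <= X (kU k m) (iU k m).
      apply: (lrp_Xle P); rewrite /iU /kU /iD /kD; lia.
    have gU : lrp_gam X Y (kU k m.+1) (iU k m.+1) =
      X (kU k m.+1) (iU k m.+1) + Y (kU k m.+1) (iU k m.+1).+1 by [].
    lia.
  apply: (@leq_trans (\sum_(0 <= i < (p + k).+1) lrp_gam X Y (kU k i) (iU k i))).
    apply: leq_trans (row _ (leqnn _)); rewrite addnC leq_add2l.
    apply: leq_trans (lrp_Xge P _ _).
    have -> : iU k (p + k) = q - k.+1 + y k; last by [].
    have := lrp_tri Q k (p + k).
    rewrite (lrp_Yfull Q (i := (p + k).+1)) => [|j]; last by rewrite -addnS => /U0.
    rewrite (U0 k) // /iU /kU; lia.
  (* [kU k i] is [kD k.+1 i], and the lattice inequality of the small hive gives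
     [iD k.+1 i <= iU k i]. *)
  rewrite /G addnS !big_nat; apply: leq_sum => i /andP[_ lti].
  have lat := lrp_lattice Q k i.
  apply: (lrp_gamle P); rewrite /iU /kU /iD /kD; lia.
have tel m : m <= q -> \sum_(0 <= i < p) b (p - i.+1 + x i) +
    \sum_(0 <= i < m) a (q - i.+1 + y i) <= G m.
  elim: m => [|m IH] lemq; first by rewrite [X in _ + X]big_geq // addn0.
  rewrite big_nat_recr //=; have := step m lemq; have := IH (ltnW lemq); lia.
apply: leq_trans (tel q (leqnn q)) _; rewrite /G !big_nat.
apply: leq_sum => i /andP[_ lti].
(* The small tableau has no letter [q] or above, so its shape is complete at [q]; the labels in
   [G q] lie on the diagonal. *)
have V0' d j : V (q + d) j = 0.
  by apply/eqP; rewrite -leqn0 -(y0 (q + d) (leq_addr d q)) (lrp_Yle_content Q).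
have Uq d : U (q + d) i = U q i.
  elim: d => [|d IH]; first by rewrite addn0.
  rewrite addnS -IH; have := lrp_tri Q (q + d) i; rewrite !V0'; lia.
have zE : U q i = z i by rewrite -(lrp_outer Q i (leq_addl q M)) Uq.
rewrite /iD V0 /kD zE; apply: (lrp_gamle_outer P); lia.
Qed.

(** * Bender-Knuth moves and the octahedron recurrence *)

Definition psum (f : nat -> nat) (i : nat) := \sum_(0 <= j < i) f j.

Lemma psum0 f : psum f 0 = 0. Proof. exact: big_geq. Qed.

Lemma psumS f i : psum f i.+1 = psum f i + f i.
Proof. by rewrite /psum big_nat_recr. Qed.

(** For partitions: [q / p] is a horizontal strip. *)
Definition interlace (p q : nat -> nat) := forall i, p i <= q i /\ q i.+1 <= p i.

(* The Bender-Knuth involution: in the chain p, q, r of horizontal strips, each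
   part of q is reflected in the interval that p and r leave to it. *)
Definition bender_knuth (p q r : nat -> nat) (i : nat) :=
  maxn (p i) (r i.+1) + (if i is j.+1 then minn (p j) (r i) else r 0) - q i.

Section BenderKnuth.
Variables p q r : nat -> nat.
Hypotheses (pq : interlace p q) (qr : interlace q r).

Let q' := bender_knuth p q r.

Lemma bender_knuth_interlacel : interlace p q'.
Proof.
move=> i; rewrite /q' /bender_knuth.
have := (pq i, pq i.+1, qr i, qr i.+1).
case: i => [|i] [[[? ?] ?] ?]; last by have := (pq i, qr i) => -[? ?]; lia.
lia.
Qed.

Lemma bender_knuth_interlacer : interlace q' r.
Proof.
move=> i; rewrite /q' /bender_knuth.
have := (pq i, pq i.+1, qr i, qr i.+1).
case: i => [|i] [[[? ?] ?] ?]; last by have := (pq i, qr i) => -[? ?]; lia.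
lia.
Qed.

(** The maximum in one part and the minimum in the next add up to [p i + r i.+1], so only the last
    maximum survives. *)
Lemma bender_knuth_psum i :
  psum q i.+1 + psum q' i.+1 = psum r i.+1 + psum p i + maxn (p i) (r i.+1).
Proof.
elim: i => [|i IH].
  rewrite !psumS !psum0 /q' /bender_knuth; have := (pq 0, qr 0) => -[? ?]; lia.
rewrite psumS [psum q' _]psumS [psum r _]psumS [psum p _]psumS.
rewrite {2}/q' /bender_knuth.
have := (pq i, pq i.+1, qr i, qr i.+1) => -[[[? ?] ?] ?]; lia.
Qed.

End BenderKnuth.

(** The right side is the maximum of [psum p i.+1 + psum r i.+1] and [psum p i + psum r i.+2], which
    is the max-plus octahedron recurrence. *)
Definition octahedron (p q q' r : nat -> nat) := forall i,
  psum q i.+1 + psum q' i.+1 = psum r i.+1 + psum p i + maxn (p i) (r i.+1).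

Lemma octahedronC p q q' r : octahedron p q q' r -> octahedron p q' q r.
Proof. by move=> h i; rewrite addnC h. Qed.

(** The lattice condition for two consecutive strips: up to row [i] the second has at most as many
    cells as the first has above row [i]. *)
Definition lattice3 (u0 u1 u2 : nat -> nat) := forall i,
  psum u2 i.+1 + psum u0 i <= psum u1 i + psum u1 i.+1.

(** Take the term attaining the maximum in the recurrence for [x0], and the matching term as lower
    bound in the one for [x2]: the claim at [i.+1] becomes [L] at [i.+1] or [i]. *)
Lemma lattice3_fwd u0 u1 u2 x0 x1 x2 :
  octahedron u0 u1 x0 x1 -> octahedron u1 u2 x1 x2 ->
  lattice3 u0 u1 u2 -> lattice3 x0 x1 x2.
Proof.
move=> o0 o1 L [|i].
  by have := (o1 0, L 0); rewrite !psumS !psum0 => -[? ?]; lia.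
have := (o0 i, o1 i, o1 i.+1, L i, L i.+1); rewrite !psumS => -[[[[? ?] ?] ?] ?].
lia.
Qed.

(** With the maximum taken in the recurrence for [u2] instead, the claim at [i] becomes [L] at [i]
    or [i.+1]. *)
Lemma lattice3_bwd u0 u1 u2 x0 x1 x2 :
  octahedron u0 u1 x0 x1 -> octahedron u1 u2 x1 x2 ->
  lattice3 x0 x1 x2 -> lattice3 u0 u1 u2.
Proof.
move=> o0 o1 L [|i].
  have := (o0 0, o1 0, L 0, L 1); rewrite !psumS !psum0 => -[[[? ?] ?] ?]; lia.
have := (o0 i, o0 i.+1, o1 i, o1 i.+1, L i.+1, L i.+2).
rewrite !psumS => -[[[[[? ?] ?] ?] ?] ?]; lia.
Qed.

(** * Exchanging inner shape and content by switching *)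

Definition truncate (s : nat) (f : nat -> nat) (i : nat) :=
  if i < s then f i else 0.

Definition switch_strip (w : nat -> nat -> nat) (start : nat -> nat) :=
  fix w' (t : nat) : nat -> nat :=
    if t is t'.+1 then bender_knuth (w' t') (w t') (w t) else start.

Section Commutor.
Variables (N : nat) (g a b : nat -> nat) (X Y : nat -> nat -> nat).
Hypothesis P : lr_pattern N g a b X Y.

(* growth j t is the partition in the growth diagram of the switching whose
   chain in t is the given tableau for j = 0 and starts from the first N - j
   parts of a in general. *)
Fixpoint growth (j : nat) : nat -> nat -> nat :=
  if j is j'.+1 then switch_strip (growth j') (truncate (N - j) a) else X.

Lemma psum_pattern k i : psum (X k.+1) i = psum (X k) i + Y k i.
Proof.
elim: i => [|i IH]; first by rewrite !psum0 (lrp_Y0 P).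
by rewrite !psumS IH; have := lrp_tri P k i; lia.
Qed.

Lemma inner_supp i : N <= i -> a i = 0.
Proof.
by move=> /(lrp_supp P) gi; have := lrp_Xle_outer P 0 i; rewrite (lrp_inner P); lia.
Qed.

Lemma growth0 j : growth j 0 =1 truncate (N - j) a.
Proof.
case: j => [|j] // i; rewrite /= (lrp_inner P) /truncate subn0.
by case: ltnP => // /inner_supp.
Qed.

Lemma growth_interlace j :
  (forall t, interlace (growth j t) (growth j t.+1)) /\
  (forall t, interlace (growth j.+1 t) (growth j t)).
Proof.
suff st j' : (forall t, interlace (growth j' t) (growth j' t.+1)) ->
    forall t, interlace (growth j'.+1 t) (growth j' t).
  elim: j => [|j [IH1 IH2]].
    have h t : interlace (growth 0 t) (growth 0 t.+1).
      by move=> i; split; [exact: lrp_incr P _ _ | exact: lrp_strict P _ _].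
    by split; [|exact: st].
  have h t : interlace (growth j.+1 t) (growth j.+1 t.+1).
    exact: bender_knuth_interlacel (IH2 t) (IH1 t).
  by split; [|exact: st].
move=> h; elim=> [|t IH]; last exact: bender_knuth_interlacer IH (h t).
move=> i; rewrite !growth0 /truncate; have := lrp_inner_anti P (leqnSn i).
case: ifP; case: ifP; case: ifP; lia.
Qed.

Lemma growth_octahedron j t :
  octahedron (growth j.+1 t) (growth j t) (growth j.+1 t.+1) (growth j t.+1).
Proof.
have [h1 h2] := growth_interlace j.
exact: bender_knuth_psum (h2 t) (h1 t).
Qed.

Lemma growth_lattice j t :
  lattice3 (growth j t) (growth j t.+1) (growth j t.+2).
Proof.
elim: j t => [|j IH] t; last first.
  exact: lattice3_bwd (octahedronC (@growth_octahedron j t))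
    (octahedronC (@growth_octahedron j t.+1)) (IH t).
move=> i; rewrite !psum_pattern; have := lrp_lattice P t i.
have := psum_pattern t.+1 i.+1; have := psum_pattern t i.+1.
by have := psum_pattern t i; rewrite /=; lia.
Qed.

(** Indexed by the number [s] of parts of [a] at the start, so that the chain grows with [s] and is
    constant from [s = N] on. *)
Definition switched s t := growth (N - s) t.

Lemma switched_octahedron s t :
  octahedron (switched s t) (switched s t.+1)
    (switched s.+1 t) (switched s.+1 t.+1).
Proof.
rewrite /switched; case: (ltnP s N) => h.
  rewrite -[N - s]prednK ?subn_gt0 // -subnS.
  exact/octahedronC/growth_octahedron.
have -> : N - s.+1 = 0 by lia.
have -> : N - s = 0 by lia.
move=> i; rewrite (maxn_idPl _) ?psumS; first lia.
by have [_] := (growth_interlace 0).1 t i.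
Qed.

Lemma switched0_psum s i : psum (switched s 0) i = psum a (minn s i).
Proof.
elim: i => [|i IH]; first by rewrite minn0 !psum0.
rewrite psumS IH /switched growth0 /truncate; case: ifP => h.
  have -> : minn s i = i by lia.
  have -> : minn s i.+1 = i.+1 by lia.
  by rewrite psumS.
have [h'|h'] := boolP (s <= i).
  have -> : minn s i.+1 = minn s i by lia.
  by rewrite addn0.
have -> : minn s i = i by lia.
have -> : minn s i.+1 = i.+1 by lia.
rewrite psumS inner_supp //; lia.
Qed.

(** At [t = 0] the strips are the single rows of [a], and the condition says that [a] decreases;
    [lattice3_fwd] carries it to all [t]. *)
Lemma switched_lattice s t :
  lattice3 (switched s t) (switched s.+1 t) (switched s.+2 t).
Proof.
elim: t s => [|t IH] s; last first.
  exact: lattice3_fwd (octahedronC (@switched_octahedron s t))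
    (octahedronC (@switched_octahedron s.+1 t)) (IH s).
move=> i; rewrite !switched0_psum; have [h|h] := boolP (i <= s).
  have -> : minn s.+2 i.+1 = i.+1 by lia.
  have -> : minn s i = i by lia.
  have -> : minn s.+1 i = i by lia.
  have -> : minn s.+1 i.+1 = i.+1 by lia.
  lia.
have -> : minn s.+2 i.+1 = s.+2 by lia.
have -> : minn s i = s by lia.
have -> : minn s.+1 i = s.+1 by lia.
have -> : minn s.+1 i.+1 = s.+1 by lia.
by rewrite !psumS; have := lrp_inner_anti P (leqnSn s); lia.
Qed.

Lemma growth_supp j t i : N <= i -> growth j t i = 0.
Proof.
move=> /(lrp_supp P) gi; suff : growth j t i <= g i by rewrite gi leqn0 => /eqP.
elim: j => [|j IH]; first exact: lrp_Xle_outer P _ _.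
exact: leq_trans ((growth_interlace j).2 t i).1 IH.
Qed.

(* The chain growth N starts from the empty partition, so it is the Yamanouchi
   chain of b: its letter t can only be in row t. *)
Lemma growth_last t i : growth N t i = truncate t b i.
Proof.
have tot j t' : psum (growth j t'.+1) N.+1 = psum (growth j t') N.+1 + b t'.
  elim: j => [|j IH]; first by rewrite psum_pattern (lrp_content P) ?leqnSn.
  have := growth_octahedron j t' N.
  rewrite !growth_supp ?leqnSn // IH !psumS !growth_supp //; lia.
have row0 t' i' : t' <= i' -> growth N t' i' = 0.
  elim: t' i' => [|t' IH] [|i'] // h; rewrite ?growth0 ?subnn //.
  by have := ((growth_interlace N).1 t' i').2; rewrite IH // leqn0 => /eqP.
(* The lattice condition keeps letter [t'] out of the rows above row [t']; with [row0], all its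
   copies lie in row [t']. *)
have lat0 t' i' : i' <= t' -> psum (growth N t'.+1) i' = psum (growth N t') i'.
  elim: t' i' => [|t' IH] [|i'] // h; rewrite ?psum0 //.
  apply/eqP; rewrite eqn_leq; apply/andP; split.
    by have := growth_lattice N t' i'; rewrite IH //; lia.
  by apply: leq_sum => j _; exact: ((growth_interlace N).1 t'.+1 j).1.
have stab t' i' : i' < t' -> growth N t'.+1 i' = growth N t' i'.
  move=> h; have := lat0 t' i'.+1 h; rewrite !psumS lat0; lia.
have tail t' m : t' <= m -> psum (growth N t') m = psum (growth N t') t'.
  move=> h; rewrite -(subnKC h); elim: (m - t') => [|d IH]; first by rewrite addn0.
  by rewrite addnS psumS IH row0 ?leq_addr // addn0.
have b0 t' : N <= t' -> b t' = 0.
  by move=> h; rewrite -(lrp_content P t' (leqnn N)) (lrp_Ydiag P).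
have new t' : growth N t'.+1 t' = b t'.
  case: (ltnP t' N) => h; last by rewrite growth_supp // b0.
  have := tot N t'; rewrite (@tail t'.+1) ?(@tail t') //; try lia.
  by rewrite psumS lat0 //; lia.
rewrite /truncate; case: ltnP => [h|]; last exact: row0.
rewrite -(subnKC h); elim: (t - i.+1) => [|d IH]; first by rewrite addn0 new.
by rewrite addnS stab //; lia.
Qed.

(** At [t = N] the growth diagram is a chain in [s] from [b] to [g] whose strips have the parts of
    [a] as sizes. *)
Lemma lr_pattern_comm :
  lr_pattern N.+1 g b a (fun k => switched k N)
    (fun k i => psum (switched k.+1 N) i - psum (switched k N) i).
Proof.
have il k : interlace (switched k N) (switched k.+1 N).
  rewrite /switched; case: (ltnP k N) => h.
    by rewrite -[N - k]prednK ?subn_gt0 // -subnS; exact: (growth_interlace _).2.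
  have -> : N - k.+1 = 0 by lia.
  have -> : N - k = 0 by lia.
  move=> i; split=> //=; rewrite !(lrp_outer P) //.
  exact: (lrp_outer_anti P (leqnSn i)).
have le k i : psum (switched k N) i <= psum (switched k.+1 N) i.
  by apply: leq_sum => j _; exact: (il k j).1.
split=> //.
- move=> k i; have := (le k i, le k i.+1, il k i); rewrite !psumS => -[[? ?] ?].
  lia.
- by move=> k i; exact: (il k i).1.
- by move=> k i; exact: (il k i).2.
- move=> k i.
  have := (le k i, le k.+1 i.+1, switched_lattice k N i) => -[[? ?] ?]; lia.
- by move=> k; rewrite !psum0.
- move=> i; rewrite /switched subn0 growth_last /truncate; case: ltnP => // h.
  by rewrite -(lrp_content P i (leqnn N)) (lrp_Ydiag P).
- move=> k i h; rewrite /switched; have -> : N - k = 0 by lia.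
  by rewrite /= (lrp_outer P).
(* The bound [N.+1] gives [i >= N], where all parts vanish; there the recurrence makes the strip
   size independent of [t], and [t = 0] is known. *)
- move=> k [//|i] h; suff tot t :
    psum (switched k.+1 t) i.+1 = psum (switched k t) i.+1 + a k.
    by rewrite tot addKn.
  elim: t => [|t IH].
    rewrite !switched0_psum; have [h'|h'] := boolP (k <= i).
      have -> : minn k.+1 i.+1 = k.+1 by lia.
      have -> : minn k i.+1 = k by lia.
      by rewrite psumS.
    have -> : minn k.+1 i.+1 = i.+1 by lia.
    have -> : minn k i.+1 = i.+1 by lia.
    rewrite inner_supp; lia.
  have := switched_octahedron k t i; rewrite IH !psumS /switched !growth_supp; lia.
- by move=> i h; apply: (lrp_supp P); lia.
Qed.

End Commutor.

(** * From Littlewood-Richardson tableaux to hives *)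

Lemma count_downset (s : pred nat) n :
  (forall i j, i <= j -> j < n -> s j -> s i) ->
  forall j, j < n -> s j = (j < count s (iota 0 n)).
Proof.
elim: n => [//|n IH] down j; rewrite ltnS => lejn.
have dn : forall i j, i <= j -> j < n -> s j -> s i.
  by move=> i k h hk; apply: down => //; exact: leqW.
rewrite -[n.+1]addn1 iotaD count_cat /= add0n addn0.
have le_n : count s (iota 0 n) <= n by rewrite -[leqRHS](size_iota 0) count_size.
case: (boolP (s n)) => sn.
  have -> : count s (iota 0 n) = n.
    rewrite -[RHS](size_iota 0); apply/eqP; rewrite -all_count; apply/allP => i.
    by rewrite mem_iota => /andP[_ h]; apply: down sn => //; exact: ltnW.
  by rewrite addn1 ltnS lejn (down _ _ lejn).
rewrite addn0; case: (ltngtP j n) lejn => // h _; first exact: IH.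
by rewrite h (negbTE sn) ltnNge le_n.
Qed.

Lemma sorted_geq_nth (s : seq nat) i j :
  sorted geq s -> i <= j -> nth 0 s j <= nth 0 s i.
Proof.
move=> ss leij; case: (ltnP j (size s)) => hj; last by rewrite nth_default.
have geq_tr : transitive geq by move=> x y z /= h1 h2; exact: leq_trans h2 h1.
apply: (sorted_leq_nth geq_tr _ 0 ss) => //; last exact: leq_ltn_trans hj.
exact: leqnn.
Qed.

Section Tableau.
Variables (g a b : seq nat) (T : filling g b).
Hypotheses (sg : sorted geq g) (sa : sorted geq a) (LR : is_LR_tableau a T).

Definition tab_entry (i j : nat) : nat :=
  if insub i is Some i' then if insub j is Some j' then T (i', j') else 0 else 0.

Let w := part_at g 0.

Lemma tab_entryE (i : 'I_(size g)) (j : 'I_w) : tab_entry i j = T (i, j).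
Proof. by rewrite /tab_entry !valK. Qed.

Lemma tab_entry_skew i j : (tab_entry i j != 0) = (nth 0 a i <= j < nth 0 g i).
Proof.
have /and4P[/andP[_ /forallP sk] _ _ _] := LR.
case: (ltnP i (size g)) => hi; last first.
  rewrite /tab_entry insubF ?(nth_default 0 hi) ?ltn0 ?andbF //.
  by apply/negbTE; rewrite -leqNgt.
case: (ltnP j w) => hj; last first.
  rewrite /tab_entry insubT insubF; last by apply/negbTE; rewrite -leqNgt.
  apply/esym/negbTE; rewrite negb_and -!ltnNge; apply/orP; right.
  by rewrite ltnS (leq_trans _ hj) // sorted_geq_nth.
by have /eqP := sk (Ordinal hi, Ordinal hj); rewrite -tab_entryE => ->.
Qed.

Lemma tab_entry_row i j j' : j <= j' -> nth 0 a i <= j -> j' < nth 0 g i ->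
  tab_entry i j <= tab_entry i j'.
Proof.
rewrite leq_eqVlt => /predU1P[->//|ltj] haj hj'g.
have /and4P[_ /forallP ss _ _] := LR.
have hi : i < size g.
  by rewrite ltnNge; apply/negP => h; move: hj'g; rewrite nth_default.
have hj' : j' < w by apply: leq_trans hj'g _; rewrite sorted_geq_nth.
have hj := ltn_trans ltj hj'.
have /forallP := ss (Ordinal hi, Ordinal hj) => /(_ (Ordinal hi, Ordinal hj')).
rewrite -!tab_entryE /in_skew /= /part_at haj hj'g (leq_trans haj (ltnW ltj)).
by rewrite (ltn_trans ltj hj'g) ltj eqxx /= => /andP[].
Qed.

Lemma tab_entry_col i j : nth 0 a i <= j -> j < nth 0 g i.+1 ->
  nth 0 a i.+1 <= j -> tab_entry i j < tab_entry i.+1 j.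
Proof.
move=> ha hg ha'; have /and4P[_ /forallP ss _ _] := LR.
have hi : i.+1 < size g.
  by rewrite ltnNge; apply/negP => h; move: hg; rewrite nth_default.
have hj : j < w by apply: leq_trans hg _; rewrite sorted_geq_nth.
have hi' := ltnW hi.
have /forallP := ss (Ordinal hi', Ordinal hj) => /(_ (Ordinal hi, Ordinal hj)).
rewrite -!tab_entryE /in_skew /= /part_at ha ha' hg.
rewrite (leq_trans hg) ?sorted_geq_nth // ltnn andbF ltnSn eqxx /=.
done.
Qed.

(** Letter [k] of the pattern is the entry [k.+1], since 0 marks an empty cell. *)
Definition tab_count k i := count (fun j => tab_entry i j == k.+1) (iota 0 w).
Definition tab_pred k i := [pred j | (j < nth 0 a i) || (0 < tab_entry i j <= k)].
Definition tab_X k i := count (tab_pred k i) (iota 0 w).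
Definition tab_Y k i := \sum_(0 <= i' < i) tab_count k i'.

Lemma tab_entry_inner i j : j < nth 0 a i -> tab_entry i j = 0.
Proof.
by move=> h; apply/eqP; rewrite -[_ == _]negbK tab_entry_skew leqNgt h.
Qed.

Lemma tab_XS k i : tab_X k.+1 i = tab_X k i + tab_count k i.
Proof.
rewrite /tab_X /tab_count -(count_predUI (tab_pred k i)) addnC.
rewrite [X in X + _](eq_count (a2 := pred0)) ?count_pred0; last first.
  move=> j /=; case: ltnP => /= h; first by rewrite tab_entry_inner.
  by apply/negbTE; lia.
by rewrite add0n; apply: eq_count => j /=; case: ltnP => //= h; lia.
Qed.

Lemma inner_le_outer i : nth 0 a i <= nth 0 g i.
Proof.
have /and4P[/andP[/allP sub _] _ _ _] := LR.
case: (ltnP i (size a)) => h; last by rewrite nth_default.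
by apply: sub; rewrite mem_iota.
Qed.

Lemma outer_le_width i : nth 0 g i <= w.
Proof. exact: sorted_geq_nth. Qed.

Lemma count_ltn_iota m n : m <= n -> count (fun j => j < m) (iota 0 n) = m.
Proof.
move=> h; rewrite -{1}(subnKC h) iotaD count_cat add0n.
rewrite (_ : count _ (iota 0 m) = m) => [|]; last first.
  rewrite -[RHS](size_iota 0 m); apply/eqP; rewrite -all_count; apply/allP => j.
  by rewrite mem_iota.
rewrite (_ : count _ _ = 0) ?addn0 //; apply/eqP; rewrite -leqn0 leqNgt -has_count.
by apply/hasPn => j; rewrite mem_iota -leqNgt => /andP[].
Qed.

Lemma tab_X_down k i : forall j j', j <= j' -> j' < w ->
  tab_pred k i j' -> tab_pred k i j.
Proof.
move=> j j' h hw /=; case: (ltnP j (nth 0 a i)) => //= haj /orP[|/andP[h0 hk]].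
  by rewrite ltnNge (leq_trans haj).
have : tab_entry i j' != 0 by rewrite -lt0n.
rewrite tab_entry_skew => /andP[_ hg].
rewrite (leq_trans (tab_entry_row h haj hg) hk) andbT lt0n tab_entry_skew haj.
exact: leq_ltn_trans hg.
Qed.

(** Rows increase weakly, so the inner cells and the entries at most [k] form an initial segment of
    the row. *)
Lemma tab_XP k i j : j < w -> tab_pred k i j = (j < tab_X k i).
Proof. exact: (count_downset (@tab_X_down k i)). Qed.

Lemma tab_entry_le i j : tab_entry i j <= size b.
Proof.
rewrite /tab_entry; case: insubP => // u _ _; case: insubP => // v _ _.
by rewrite -ltnS.
Qed.

Definition tab_rows i :=
  flatten [seq [seq tab_entry i' j | j <- rev (iota 0 w)] | i' <- iota 0 i].

Lemma count_tab_rows k i : count_mem k.+1 (tab_rows i) = tab_Y k i.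
Proof.
rewrite /tab_rows /tab_Y count_flatten -map_comp sumnE big_map /index_iota subn0.
by apply: eq_bigr => i' _; rewrite /= count_map count_rev.
Qed.

Lemma reading_wordE :
  reading_word T = [seq x <- tab_rows (size g) | x != 0].
Proof.
congr filter; rewrite /tab_rows -!val_enum_ord -map_comp; congr flatten.
apply: eq_map => i /=; rewrite -map_rev -map_comp.
by apply: eq_map => j /=; rewrite tab_entryE.
Qed.

Lemma tab_Y_size k i : size g <= i -> tab_Y k i = tab_Y k (size g).
Proof.
move=> h; rewrite /tab_Y (big_cat_nat _ h) //=.
rewrite [X in _ + X]big_nat [X in _ + X]big1 ?addn0 //.
move=> i' /andP[h' _]; rewrite /tab_count (eq_count (a2 := pred0)) ?count_pred0 //.
move=> j /=; have -> : tab_entry i' j = 0; last by [].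
apply/eqP; rewrite -[_ == _]negbK tab_entry_skew (@nth_default _ 0 g) //.
by rewrite ltn0 andbF.
Qed.

Lemma tab_lattice k i : tab_Y k.+1 i.+1 <= tab_Y k i.
Proof.
have /and4P[_ _ _ /asboolP lat] := LR.
have nz c s : count_mem c.+1 [seq x <- s | x != 0] = count_mem c.+1 s.
  by rewrite count_filter; apply: eq_count => x /=; case: eqP => // ->.
case: (ltnP i (size g)) => hi; last first.
  have := lat (size (reading_word T)) k.+1 isT.
  rewrite take_size reading_wordE !nz !count_tab_rows !tab_Y_size //.
  exact: leqW.
(* Cut the reading word once column [m] of row [i] is read: this prefix has all entries [k.+2] of
   the row and none of its entries [k.+1]. *)
pose m := tab_X k.+1 i.
have lemw : m <= w by rewrite /m /tab_X -[leqRHS](size_iota 0) count_size.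
pose w1 := tab_rows i ++ [seq tab_entry i j | j <- rev (iota m (w - m))].
have [w2 Ew] : exists w2, tab_rows (size g) = w1 ++ w2.
  rewrite /tab_rows -(subnKC hi) iotaD -addn1 iotaD !map_cat !flatten_cat /=.
  rewrite /w1 -/(tab_rows i) cats0 add0n -{1}(subnKC lemw) iotaD rev_cat map_cat.
  by eexists; rewrite !add0n -!catA; reflexivity.
have := lat (size [seq x <- w1 | x != 0]) k.+1 isT.
have -> : reading_word T = [seq x <- w1 | x != 0] ++ [seq x <- w2 | x != 0].
  by rewrite -filter_cat -Ew reading_wordE.
rewrite take_size_cat //.
rewrite !nz /w1 !count_cat !count_tab_rows !count_map !count_rev.
have rest c : count (preim (tab_entry i) (pred1 c.+1)) (iota m (w - m)) +
    count (preim (tab_entry i) (pred1 c.+1)) (iota 0 m) = tab_count c i.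
  by rewrite /tab_count -(subnKC lemw) iotaD count_cat addnC subnKC.
rewrite [X in _ <= _ + X](_ : _ = 0) ?addn0; last first.
  apply/eqP; rewrite -leqn0 leqNgt -has_count; apply/hasPn => j.
  rewrite mem_iota subnKC // => /andP[mj jw] /=.
  by have := tab_XP k.+1 i jw; rewrite /= [RHS]ltnNge mj /=; lia.
have := rest k.+1; rewrite [X in _ + X](_ : _ = 0); last first.
  apply/eqP; rewrite -leqn0 leqNgt -has_count; apply/hasPn => j.
  rewrite mem_iota add0n => /= jm; have jw := leq_trans jm lemw.
  have := tab_XP k.+1 i jw; rewrite /= [RHS]jm => /orP[/tab_entry_inner->//|]; lia.
by rewrite addn0 => ->; rewrite /tab_Y big_nat_recr.
Qed.

Lemma lr_pattern_tableau :
  lr_pattern (size g + size b) (nth 0 g) (nth 0 a) (nth 0 b) tab_X tab_Y.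
Proof.
have X0 i : tab_X 0 i = nth 0 a i.
  rewrite -(count_ltn_iota (leq_trans (inner_le_outer i) (outer_le_width i))).
  by apply: eq_count => j /=; case: ltnP => //= _; lia.
split=> //.
- by move=> k i; rewrite tab_XS /tab_Y big_nat_recr //=; lia.
- by move=> k i; rewrite tab_XS leq_addr.
- move=> k i; rewrite leqNgt; apply/negP => h.
  have lew : tab_X k.+1 i.+1 <= w by rewrite -[leqRHS](size_iota 0) count_size.
  have hw := leq_trans h lew.
  have := tab_XP k i hw; have := tab_XP k.+1 i.+1 hw; rewrite ltnn h /=.
  (* In column [j] the entry of row [i] would be at least [k.+1] and that of row [i.+1] at most
     [k.+1], against column strictness. *)
  set j := tab_X k i => h1 h2.
  have haj : nth 0 a i <= j by lia.
  have haj' : nth 0 a i.+1 <= j by exact: leq_trans (sorted_geq_nth sa _) haj.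
  have : tab_entry i.+1 j != 0 by lia.
  rewrite tab_entry_skew => /andP[_ hg]; have := tab_entry_col haj hg haj'.
  have : tab_entry i j != 0.
    by rewrite tab_entry_skew haj (leq_trans hg) // sorted_geq_nth.
  lia.
- exact: tab_lattice.
- by move=> k; rewrite /tab_Y big_geq.
- move=> k i h; rewrite -(count_ltn_iota (outer_le_width i)).
  apply: eq_count => j /=; have := inner_le_outer i; have := tab_entry_skew i j.
  have := tab_entry_le i j; lia.
- move=> k i h; rewrite tab_Y_size; last by lia.
  have /and4P[_ _ /forallP cont _] := LR.
  case: (ltnP k (size b)) => hk; last first.
    rewrite nth_default // /tab_Y big1 // => i' _.
    rewrite /tab_count (eq_count (a2 := pred0)) ?count_pred0 // => j /=.
    by have := tab_entry_le i' j; lia.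
  have /eqP := cont (Ordinal hk); rewrite /part_at /= => <-.
  rewrite -sum1_card /tab_Y big_mkord.
  transitivity (\sum_(i < size g) \sum_(j < w | T (i, j) == k.+1 :> nat) 1).
    apply: eq_bigr => i' _; rewrite /tab_count -sum1_count.
    rewrite -[w in iota 0 w]subn0 -/(index_iota 0 w) big_mkord.
    by apply: eq_bigl => j; rewrite tab_entryE.
  by rewrite pair_big_dep /=; apply: eq_bigl => -[i' j]; rewrite !inE.
- by move=> i h; rewrite nth_default //; lia.
Qed.


End Tableau.

(** [N] is existential because exchanging [a] and [b] raises it. *)
Definition lr_positive (g a b : nat -> nat) :=
  exists N X Y, lr_pattern N g a b X Y.

Lemma lr_positiveC g a b : lr_positive g a b -> lr_positive g b a.
Proof. by move=> [N [X [Y P]]]; do 3!eexists; exact: lr_pattern_comm P. Qed.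

Lemma lr_positive_lrcoef (g a b : seq nat) :
  sorted geq g -> sorted geq a -> 0 < lrcoef g a b ->
  lr_positive (nth 0 g) (nth 0 a) (nth 0 b).
Proof.
move=> sg sa /lrcoef_gt0P[T LR].
by do 3!eexists; exact: lr_pattern_tableau sg sa LR.
Qed.

(** * Horn inequalities indexed by subsets *)

Section SubsetPartition.
Variables (n : nat) (I : {set 'I_n}).

Let e := [seq val i | i <- enum I].

Lemma sorted_enum_set : sorted ltn e.
Proof.
rewrite sorted_map /enum_mem; apply: sorted_filter; first exact: ltn_trans.
by rewrite -enumT -sorted_map val_enum_ord iota_ltn_sorted.
Qed.

Lemma size_enum_set : size e = #|I|.
Proof. by rewrite size_map -cardE. Qed.

Lemma enum_set_step k : k.+1 < #|I| -> nth 0 e k < nth 0 e k.+1.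
Proof. by rewrite -size_enum_set => h; apply: (sortedP 0 sorted_enum_set). Qed.

Lemma enum_set_ge k : k < #|I| -> k <= nth 0 e k.
Proof.
elim: k => [//|k IH] h; apply: leq_ltn_trans (enum_set_step h).
exact/IH/ltnW.
Qed.

Lemma size_tau : size (tau I) = #|I|.
Proof. by rewrite size_rev size_mkseq. Qed.

(** This turns the indices [r - i.+1 + z i] of the Horn inequalities into the elements of the
    subset, in decreasing order. *)
Lemma nth_tau i : i < #|I| ->
  #|I| - i.+1 + nth 0 (tau I) i = nth 0 e (#|I| - i.+1).
Proof.
move=> h; rewrite nth_rev size_mkseq // nth_mkseq; last by lia.
by rewrite subnKC //; apply: enum_set_ge; lia.
Qed.

Lemma sorted_tau : sorted geq (tau I).
Proof.
rewrite rev_sorted; apply/(sortedP 0) => k; rewrite size_mkseq => h.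
rewrite !nth_mkseq //; last by exact: ltnW.
by have := enum_set_step h; have := enum_set_ge (ltnW h); rewrite /e /=; lia.
Qed.

Lemma sum_tau (f : nat -> nat) :
  \sum_(i in I) f i = \sum_(0 <= i < #|I|) f (#|I| - i.+1 + nth 0 (tau I) i).
Proof.
rewrite -big_enum /= -(big_map val predT f) -/e (big_nth 0).
rewrite size_enum_set big_nat_rev /= !big_nat; apply: eq_bigr => i /andP[_ h].
by rewrite add0n nth_tau.
Qed.

End SubsetPartition.

(** The inner partition of the small hive meets the content of the big one and conversely, so [I]
    selects parts of [b] and [J] parts of [a]. *)
Lemma horn_upper_tau n (I J K : {set 'I_n}) g a b :
  lr_positive g a b -> 0 < lrcoef (tau K) (tau I) (tau J) ->
  #|I| = #|K| -> #|J| = #|K| ->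
  \sum_(i in K) g i <= \sum_(i in I) b i + \sum_(i in J) a i.
Proof.
move=> [N [X [Y P]]] lr cI cJ.
have [M [U [V Q]]] := lr_positive_lrcoef (sorted_tau K) (sorted_tau I) lr.
rewrite !sum_tau cI cJ; apply: (horn_upper P Q) => i h.
by rewrite nth_default // size_tau.
Qed.

Lemma horn_lower_tau n (I J K : {set 'I_n}) g a b :
  lr_positive g a b -> 0 < lrcoef (tau K) (tau I) (tau J) ->
  #|K| = #|I| + #|J| ->
  \sum_(i in I) b i + \sum_(i in J) a i <= \sum_(i in K) g i.
Proof.
move=> [N [X [Y P]]] lr cK.
have [M [U [V Q]]] := lr_positive_lrcoef (sorted_tau K) (sorted_tau I) lr.
rewrite !sum_tau cK; apply: (horn_lower P Q) => i h.
  by rewrite nth_default // size_tau.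
by rewrite nth_default // size_tau.
Qed.

(** * The extended Horn inequality *)

Lemma NL_gt0 mu nu lambda : 0 < NL mu nu lambda ->
  exists t, 0 < NL_term mu nu lambda t.
Proof.
rewrite lt0n => NL0; apply: contrapT => h; case/eqP: NL0.
apply: fsbig1 => t _; apply/eqP; rewrite -leqn0 leqNgt; apply/negP => ht.
by apply: h; exists t.
Qed.

Lemma sorted_intpart (p : intpart) : sorted geq p.
Proof. by case: p => s /= /andP[]. Qed.

Theorem theorem1p3 (n : nat) (mu nu lambda : n.-tuple nat)
    (A A' B B' C C' : {set 'I_n}) :
  (1 <= n)%N ->
  mu \in Par n -> nu \in Par n -> lambda \in Par n ->
  (0 < NL mu nu lambda)%N ->
  calG A A' B B' C C' ->
  (0 <= \sum_(i in A) (tnth mu i)%:Z - \sum_(i in A') (tnth mu i)%:Z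
      + \sum_(j in B) (tnth nu j)%:Z - \sum_(j in B') (tnth nu j)%:Z
      + \sum_(k in C) (tnth lambda k)%:Z - \sum_(k in C') (tnth lambda k)%:Z)%R.
Proof.
move=> _ smu snu sla /NL_gt0[[[al be] ga]] /=.
rewrite !muln_gt0 => /andP[/andP[lrmu lrnu] lrla].
case=> _ [cA cB cC] [A1 [A2 [B1 [B2 [C1 [C2 [[cA12 cB12 cC12] [hA' hB' hC']]]]]]]].
move: cA12 cB12 cC12 => [cA1 cA2] [cB1 cB2] [cC1 cC2] [hA hB hC].
have {lrmu} pmu := lr_positive_lrcoef smu (sorted_intpart al) lrmu.
have {lrnu} pnu := lr_positive_lrcoef snu (sorted_intpart al) lrnu.
have {lrla} pla := lr_positive_lrcoef sla (sorted_intpart be) lrla.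
(* Commutativity is applied so that [A1], [C2] select parts of [be], [A2], [B1] of [al], and [B2],
   [C1] of [ga] in both the upper and the lower inequalities; these sums cancel. *)
have uA := horn_upper_tau pmu hA' cA1 cA2.
have uB := horn_upper_tau (lr_positiveC pnu) hB' cB1 cB2.
have uC := horn_upper_tau pla hC' cC1 cC2.
have lA : #|A| = #|B1| + #|C2| by rewrite cB1 cC2.
have lB : #|B| = #|C1| + #|A2| by rewrite cC1 cA2 addnC.
have lC : #|C| = #|A1| + #|B2| by rewrite cA1 cB2.
have {lA} := horn_lower_tau (lr_positiveC pmu) hA lA.
have {lB} := horn_lower_tau pnu hB lB.
have {lC} := horn_lower_tau (lr_positiveC pla) hC lC.
have sumE (s : n.-tuple nat) (D : {set 'I_n}) :
    (\sum_(i in D) (tnth s i)%:Z)%R = Posz (\sum_(i in D) nth 0 s i).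
  by rewrite (big_morph Posz PoszD (erefl _)); apply: eq_bigr => i _;
     rewrite (tnth_nth 0).
rewrite !sumE; lia.
Qed.
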